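(* Let $P_3=NEEN$ and $P_4=ENNE$, and let $$F_{3,4}(x_3,x_4,t)=1+\sum_{n\ge 1}t^n\sum_{L\in\mathcal{L}_n}x_3^{P_3\text{-mch}(L)}x_4^{P_4\text{-mch}(L)}.$$ Then, with $C(t)=\frac{1-\sqrt{1-4t}}{2t}$, $$F_{3,4}(x_3,x_4,t)=C(t)+\frac{\left(1-C(t)\right)\left(1-x_3+C(t)x_3\right)\left(1-x_4+C(t)x_4\right)}{-1+\left(-1+C(t)\right)^2x_3x_4}.$$
   Context: $\mathcal{L}_n$ is the set of lattice paths from $(0,0)$ to $(n,n)$ consisting of unit north steps $N$ and unit east steps $E$, equivalently words with $n$ letters $E$ and $n$ letters $N$. For $L\in\mathcal{L}_n$ and $A\subseteq\{1,\dots,n\}$, $ps_L(A)$ is the word obtained from $L$ by deleting, for every $i\in\{1,\dots,n\}\setminus A$, the $i$-th occurrence of $E$ and the $i$-th occurrence of $N$ (reading from left to right). For $P\in\mathcal{L}_2$, $P\text{-mch}(L)$ is the number of $j\in\{1,\dots,n-1\}$ with $ps_L(\{j,j+1\})=P$. Identities are between formal power series in $t$ with coefficients polynomial in $x_3,x_4$; $\sqrt{1-4t}$ denotes the formal power series square root with constant term $1$, so $C(t)$ is the generating function of the Catalan numbers. *)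

(* Defs.v *)
From HB Require Import structures.
From mathcomp Require Import all_boot all_order all_algebra.
From mathcomp Require Import boolp.
From mathcomp Require Import mpoly.

Set Implicit Arguments.
Unset Strict Implicit.
Unset Printing Implicit Defensive.

Import GRing.Theory.
Local Open Scope ring_scope.

Record fps (R : Type) := Fps { fcoef : nat -> R }.

Lemma fpsP (R : Type) (a b : fps R) : (forall n, fcoef a n = fcoef b n) -> a = b.
Proof. by case: a b => [a] [b] /= /funext ->. Qed.

HB.instance Definition _ (R : Type) := gen_eqMixin (fps R).
HB.instance Definition _ (R : Type) := gen_choiceMixin (fps R).

(** Course-of-values recursion: coefficient [n] is computed by [step n] from
    the sequence agreeing with the series below [n] and vanishing from [n] on. *)
Section CourseOfValues.
Variables (R : nmodType) (step : nat -> (nat -> R) -> R).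

Fixpoint fps_below (n : nat) : nat -> R :=
  if n is m.+1 then
    fun k => if k == m then step m (fps_below m) else fps_below m k
  else fun=> 0.

Definition fps_rec : fps R := Fps (fun n => step n (fps_below n)).

Lemma fps_belowE n k : fps_below n k = if (k < n)%N then fcoef fps_rec k else 0.
Proof.
elim: n k => [|n IHn] k //=; rewrite ltnS leq_eqVlt.
by case: eqP => [->|_] //=; rewrite IHn.
Qed.

Lemma fps_recE n : fcoef fps_rec n =
  step n (fun k => if (k < n)%N then fcoef fps_rec k else 0).
Proof. by rewrite -(funext (fps_belowE n)). Qed.

End CourseOfValues.

Section Ring.
Variable R : comNzRingType.
Implicit Types a b c : fps R.

Definition fps_const (r : R) : fps R := Fps (fun n => if n == 0%N then r else 0).
Definition fps_t : fps R := Fps (fun n => (n == 1%N)%:R).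
Definition fps_add a b : fps R := Fps (fun n => fcoef a n + fcoef b n).
Definition fps_opp a : fps R := Fps (fun n => - fcoef a n).
Definition fps_mul a b : fps R :=
  Fps (fun n => \sum_(j < n.+1) fcoef a j * fcoef b (n - j)).

Fact fps_addA : associative fps_add.
Proof. by move=> a b c; apply: fpsP => n; apply: addrA. Qed.
Fact fps_addC : commutative fps_add.
Proof. by move=> a b; apply: fpsP => n; apply: addrC. Qed.
Fact fps_add0 : left_id (fps_const 0) fps_add.
Proof. by move=> a; apply: fpsP => n /=; case: ifP; rewrite add0r. Qed.
Fact fps_addN : left_inverse (fps_const 0) fps_opp fps_add.
Proof. by move=> a; apply: fpsP => n /=; rewrite addNr; case: ifP. Qed.

HB.instance Definition _ :=
  GRing.isZmodule.Build (fps R) fps_addA fps_addC fps_add0 fps_addN.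

Fact fps_mulC : commutative fps_mul.
Proof.
move=> a b; apply: fpsP => n /=; rewrite (reindex_inj rev_ord_inj) /=.
by apply: eq_bigr => j _; rewrite subSS mulrC subKn // -ltnS.
Qed.

Fact fps_mulA : associative fps_mul.
Proof.
move=> a b c; rewrite (fps_mulC b); apply: fpsP => n /=.
rewrite [RHS](reindex_inj rev_ord_inj) /=.
pose coef3 j k := fcoef a j * (fcoef c k * fcoef b (n - j - k)).
transitivity (\sum_(j < n.+1) \sum_(k < n.+1 | (k <= n - j)%N) coef3 j k).
  by apply: eq_bigr => /= j _; rewrite big_distrr /= (big_ord_narrow_leq (leq_subr _ _)).
rewrite (exchange_big_dep predT) //=; apply: eq_bigr => k _; rewrite subSS.
transitivity (\sum_(j < n.+1 | (j <= n - k)%N) coef3 j k).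
  apply: eq_bigl => j; rewrite -ltnS -(ltnS j) -!subSn ?leq_ord //.
  by rewrite -subn_gt0 -(subn_gt0 j) -!subnDA addnC.
rewrite (big_ord_narrow_leq (leq_subr _ _)) big_distrl /=.
apply: eq_bigr => j _; rewrite /coef3 subKn -1?ltnS // -!subnDA addnC.
by rewrite -mulrA (mulrC (fcoef c k)).
Qed.

Fact fps_mul1 : left_id (fps_const 1) fps_mul.
Proof.
move=> a; apply: fpsP => n /=; rewrite big_ord_recl /= subn0 mul1r.
by rewrite big1 ?addr0 // => i _; rewrite mul0r.
Qed.

Fact fps_mulDl : left_distributive fps_mul fps_add.
Proof.
move=> a b c; apply: fpsP => n /=; rewrite -big_split.
by apply: eq_bigr => j _; rewrite mulrDl.
Qed.

Fact fps_1neq0 : fps_const 1 != 0.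
Proof. by apply/eqP => /(congr1 (fun a => fcoef a 0)) /eqP /=; rewrite oner_eq0. Qed.

HB.instance Definition _ := GRing.Zmodule_isComNzRing.Build (fps R)
  fps_mulA fps_mulC fps_mul1 fps_mulDl fps_1neq0.

Lemma fcoef0 n : fcoef (0 : fps R) n = 0.
Proof. by rewrite /=; case: ifP. Qed.
Lemma fcoef1 n : fcoef (1 : fps R) n = (n == 0%N)%:R.
Proof. by rewrite /=; case: ifP. Qed.
Lemma fcoefD a b n : fcoef (a + b) n = fcoef a n + fcoef b n.
Proof. by []. Qed.
Lemma fcoefN a n : fcoef (- a) n = - fcoef a n.
Proof. by []. Qed.
Lemma fcoefM a b n :
  fcoef (a * b) n = \sum_(j < n.+1) fcoef a j * fcoef b (n - j).
Proof. by []. Qed.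

Lemma fcoefM0 a b : fcoef (a * b) 0 = fcoef a 0 * fcoef b 0.
Proof. by rewrite fcoefM big_ord1. Qed.

Lemma fcoef_nat k n : fcoef (k%:R : fps R) n = if n == 0%N then k%:R else 0.
Proof.
elim: k => [|k IHk]; first by rewrite fcoef0; case: ifP.
by rewrite !mulrS fcoefD fcoef1 IHk; case: eqP => //=; rewrite addr0.
Qed.

Lemma fcoef_tM a n : fcoef (fps_t * a) n = if n is m.+1 then fcoef a m else 0.
Proof.
case: n => [|n]; first by rewrite fcoefM0 mul0r.
rewrite fcoefM !big_ord_recl big1 ?addr0 => [|i _]; last by rewrite mul0r.
by rewrite mul0r add0r mul1r /= subSS subn0.
Qed.

(** Exact division by [t], for series without constant term. *)
Definition fps_divt a : fps R := Fps (fun n => fcoef a n.+1).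

Lemma fcoef_divt a n : fcoef (fps_divt a) n = fcoef a n.+1.
Proof. by []. Qed.

Lemma fps_divtK a : fcoef a 0 = 0 -> fps_t * fps_divt a = a.
Proof. by move=> a0; apply: fpsP => n; rewrite fcoef_tM; case: n. Qed.

End Ring.

Section UnitRing.
Variable R : comUnitRingType.
Implicit Types a b : fps R.

Definition fps_unit : {pred fps R} := [pred a | fcoef a 0 \is a GRing.unit].

Definition fps_inv a : fps R :=
  if a \in fps_unit then
    fps_rec (fun n r => (fcoef a 0)^-1 *
      ((n == 0%N)%:R - \sum_(j < n.+1 | j != 0%N :> nat) fcoef a j * r (n - j)%N))
  else a.

Fact fps_mulV : {in fps_unit, left_inverse 1 fps_inv *%R}.
Proof.
move=> a ua; rewrite mulrC; apply: fpsP => n; rewrite fcoefM fcoef1.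
rewrite (bigD1 ord0) //= subn0 /fps_inv ua; move: ua; rewrite inE => ua.
set r := fps_rec _; rewrite [fcoef r n]fps_recE mulVKr // -/r.
rewrite -[RHS]subr0 -addrA; congr (_ + _).
rewrite addrC -sumrB oppr0 big1 // => j j0.
have j_gt0 : (0 < j)%N by rewrite lt0n.
have n_gt0 : (0 < n)%N by rewrite (leq_trans j_gt0) // -ltnS.
by rewrite ltn_subrL j_gt0 n_gt0 subrr.
Qed.

Fact fps_unitPl a b : b * a = 1 -> a \in fps_unit.
Proof.
move=> /(congr1 (fun c => fcoef c 0)); rewrite fcoefM0 fcoef1 inE /= => ba.
by apply/unitrPr; exists (fcoef b 0); rewrite mulrC.
Qed.

Fact fps_inv_out : {in [predC fps_unit], fps_inv =1 id}.
Proof. by move=> a; rewrite inE /fps_inv => /negbTE ->. Qed.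

HB.instance Definition _ :=
  GRing.ComNzRing_hasMulInverse.Build (fps R) fps_mulV fps_unitPl fps_inv_out.

Lemma fps_unitE a : (a \is a GRing.unit) = (fcoef a 0 \is a GRing.unit).
Proof. by []. Qed.

(** The square root with constant term [1] of a series with constant term [1];
    [2] has to be invertible in [R]. *)
Definition fps_sqrt a : fps R :=
  fps_rec (fun n s => if n == 0%N then 1 else
    (fcoef a n - \sum_(1 <= j < n) s j * s (n - j)%N) / 2%:R).

Lemma fcoef_sqrt0 a : fcoef (fps_sqrt a) 0 = 1.
Proof. by rewrite fps_recE. Qed.

Lemma fcoef_sqrtS a n : fcoef (fps_sqrt a) n.+1 =
  (fcoef a n.+1 - \sum_(1 <= j < n.+1)
     fcoef (fps_sqrt a) j * fcoef (fps_sqrt a) (n.+1 - j)) / 2%:R.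
Proof.
rewrite [LHS]fps_recE /=; congr ((_ - _) / _); apply: eq_big_nat => j.
by case/andP=> j_gt0 ->; rewrite ltn_subrL j_gt0.
Qed.

Lemma fps_sqrtK a : (2%:R : R) \is a GRing.unit -> fcoef a 0 = 1 ->
  fps_sqrt a ^+ 2 = a.
Proof.
move=> u2 a0; apply: fpsP => -[|n]; rewrite expr2.
  by rewrite fcoefM0 fcoef_sqrt0 mulr1.
rewrite fcoefM -(big_mkord xpredT
  (fun j => fcoef (fps_sqrt a) j * fcoef (fps_sqrt a) (n.+1 - j))).
rewrite big_nat_recr // big_ltn // subn0 subnn.
rewrite fcoef_sqrt0 mul1r mulr1 fcoef_sqrtS; set s := \sum_(_ <= j < _) _.
rewrite /= addrAC -mulrDl -mulr2n -[_ *+ 2]mulr_natr mulrK //.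
by rewrite subrK.
Qed.

(** [C(t) = (1 - sqrt (1 - 4 t)) / (2 t)] *)
Definition catalan_gf : fps R :=
  fps_divt (1 - fps_sqrt (1 - 4%:R * fps_t R)) / 2%:R.

Lemma catalan_gfE : (2%:R : R) \is a GRing.unit ->
  2%:R * fps_t R * catalan_gf = 1 - fps_sqrt (1 - 4%:R * fps_t R).
Proof.
move=> u2; rewrite /catalan_gf mulrC mulrA divrK.
  by rewrite mulrC fps_divtK // fcoefD fcoefN fcoef1 fcoef_sqrt0 subrr.
by rewrite fps_unitE fcoef_nat.
Qed.

Lemma fcoef_catalan0 : (2%:R : R) \is a GRing.unit -> fcoef catalan_gf 0 = 1.
Proof.
move=> u2; rewrite /catalan_gf fcoefM0.
have -> : fcoef (2%:R^-1 : fps R) 0 = 2%:R^-1.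
  apply: (mulrI u2); rewrite divrr // -[X in X * _](fcoef_nat R 2 0) -fcoefM0.
  by rewrite divrr ?fcoef1 // fps_unitE fcoef_nat.
rewrite fcoef_divt fcoefD fcoefN fcoef1 sub0r.
rewrite fcoef_sqrtS big_geq // subr0 fcoefD fcoefN fcoef1 sub0r.
rewrite (mulrC 4%:R) fcoef_tM fcoef_nat eqxx !mulNr opprK.
by rewrite (natrM R 2 2) mulrK // divrr.
Qed.

End UnitRing.

(** [true] is an east step, [false] a north step. *)
Definition step := bool.
Definition East : step := true.
Definition North : step := false.

Definition lattice_paths (n : nat) : {set (n + n).-tuple step} :=
  [set L : (n + n).-tuple step |
    (count_mem East L == n) && (count_mem North L == n)].

(** The letter of [L] at position [k] (counted from [0]) is the
    [occurrence L k]-th (counted from [1]) letter of its kind. *)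
Definition occurrence (L : seq step) (k : nat) : nat :=
  count_mem (nth East L k) (take k.+1 L).

(** Occurrences are numbered from [1], so only the elements of [A] between [1]
    and [n] matter when [L] is a path to [(n, n)]. *)
Definition ps (L : seq step) (A : pred nat) : seq step :=
  mask [seq A (occurrence L k) | k <- iota 0 (size L)] L.

Definition mch (P : seq step) (n : nat) (L : seq step) : nat :=
  count (fun j => ps L (pred2 j j.+1) == P) (iota 1 n.-1).

Definition P3 : seq step := [:: North; East; East; North].
Definition P4 : seq step := [:: East; North; North; East].

Definition x3 : {mpoly rat[2]} := 'X_ord0.
Definition x4 : {mpoly rat[2]} := 'X_ord_max.

Definition F34 : fps {mpoly rat[2]} :=
  1 + Fps (fun n => if n == 0%N then 0 else
             \sum_(L : (n + n).-tuple step | L \in lattice_paths n)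
               x3 ^+ mch P3 n L * x4 ^+ mch P4 n L).

Lemma unit2 : (2%:R : {mpoly rat[2]}) \is a GRing.unit.
Proof. by rewrite -mpolyC_nat; apply: rmorph_unit; rewrite unitfE Num.Theory.pnatr_eq0. Qed.

(** The denominator of the closed form is invertible, so that the division there
    is a genuine one. *)
Lemma denom_unit (R : comUnitRingType) (a b : fps R) :
  (2%:R : R) \is a GRing.unit ->
  -1 + (-1 + catalan_gf R) ^+ 2 * a * b \is a GRing.unit.
Proof.
move=> u2; rewrite fps_unitE fcoefD expr2 !fcoefM0 fcoefD !fcoefN fcoef1.
by rewrite fcoef_catalan0 // addNr !mul0r addr0 unitrN1.
Qed.

(* Main.v *)
Require Import Defs.
From mathcomp Require Import all_boot all_order all_algebra.
From mathcomp Require Import zify ring.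
From mathcomp Require Import mpoly.
Import GRing.Theory.
Local Open Scope ring_scope.

(** A block [NEEN] (resp. [ENNE]) at [j, j+1] means that the path crosses the
    diagonal at [(j, j)] by two consecutive east (resp. north) steps.  Weight each
    path by these crossings and append steps one at a time.  If [P c] is the
    generating function of the nonempty balanced words ending with [c], the words
    with [p] letters [c] and [p + h] letters [~~ c], [h > 0], are counted by the
    coefficient of [t ^ p] in [C ^ (h + 1) * (1 + x (~~ c) * P (~~ c))]: this
    follows by induction on the length from [C = 1 + t * C ^ 2], and [P] is then
    the solution of [P c = t * C ^ 2 * (1 + x (~~ c) * P (~~ c))]. *)

(** * Blocks of a path and its straight crossings of the diagonal *)

Lemma ps_cat_mask (w r : seq step) (A : pred nat) :
  ps (w ++ r) A = ps w A ++
    mask [seq A (occurrence (w ++ r) k) | k <- iota (size w) (size r)] r.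
Proof.
rewrite /ps size_cat iotaD add0n map_cat mask_cat ?size_map ?size_iota //.
(* Occurrence numbers only look backwards, so appending [r] leaves the mask on [w] unchanged. *)
congr (mask _ _ ++ _); apply/eq_in_map => k.
rewrite mem_iota add0n /= => kw; rewrite /occurrence nth_cat kw take_cat.
case: ltnP => // wk; have sw : size w = k.+1 by lia.
by rewrite sw subnn take0 cats0 -sw take_size.
Qed.

Lemma ps_rcons (w : seq step) (y : step) (A : pred nat) :
  ps (rcons w y) A = ps w A ++ nseq (A (count_mem y w).+1) y.
Proof.
rewrite -cats1 ps_cat_mask /= /occurrence nth_cat ltnn subnn /=.
rewrite take_oversize ?size_cat ?addn1 // count_cat /= eqxx addn0 addn1.
by case: (A _).
Qed.

Lemma prefix_ps (w r : seq step) (A : pred nat) : prefix (ps w A) (ps (w ++ r) A).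
Proof. by rewrite ps_cat_mask prefix_prefix. Qed.

Lemma count_ps (c : step) (L : seq step) (A : pred nat) :
  count_mem c (ps L A) = count A (iota 1 (count_mem c L)).
Proof.
elim/last_ind: L => [|w y IHw] //.
rewrite ps_rcons -cats1 !count_cat IHw iotaD count_cat add1n; congr addn.
by rewrite count_nseq /=; case: eqP => [->|_] /=; rewrite ?mul1n ?addn0.
Qed.

Lemma count_ps_pred2 (c : step) (L : seq step) (j : nat) : (0 < j)%N ->
  count_mem c (ps L (pred2 j j.+1)) =
  ((j <= count_mem c L) + (j < count_mem c L))%N.
Proof.
move=> j0; rewrite count_ps; elim: (count_mem c L) => [|m IHm]; first by case: j j0.
by rewrite -[m.+1]addn1 iotaD count_cat IHm /= add1n; lia.
Qed.

Lemma count_mem_step (c : step) (L : seq step) :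
  (count_mem c L + count_mem (~~ c) L)%N = size L.
Proof. by elim: L => //= -[] L <-; case: c; rewrite /= ?addnS. Qed.

Definition balanced (L : seq step) : bool := (count_mem East L).*2 == size L.

Lemma balancedE (c : step) (L : seq step) :
  balanced L = ((count_mem c L).*2 == size L).
Proof.
case: c => //; rewrite /balanced -(count_mem_step false L) /= /East.
by move: (count_mem true L) (count_mem false L) => m k; lia.
Qed.

(** The default letter [~~ c] rules out [k = 0] and [size L <= k]. *)
Definition straight (c : step) (L : seq step) (k : nat) : bool :=
  [&& balanced (take k L), last (~~ c) (take k L) == c & nth (~~ c) L k == c].

(** When the prefix of length [j.*2] is balanced, its last letter is the [j]-th of its kind and the
    next letter is the [j.+1]-st of its kind. They are the two middle letters of the block, and
    counting letters then determines the outer two. *)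
Lemma ps_pred2_straight (c : step) (n j : nat) (L : seq step) :
  count_mem c L = n -> size L = n.*2 -> (0 < j < n)%N ->
  (ps L (pred2 j j.+1) == [:: ~~ c; c; c; ~~ c]) = straight c L j.*2.
Proof.
move=> cL sL /andP[j0 jn].
have cL' : count_mem (~~ c) L = n.
  by apply: (@addnI n); rewrite -{1}cL count_mem_step sL addnn.
set w := take j.*2 L; have sw : size w = j.*2.
  by rewrite size_takel // sL leq_double ltnW.
have Lw : L = w ++ drop j.*2 L by rewrite cat_take_drop.
have cw := count_mem_step c w; rewrite sw in cw.
rewrite /straight -/w (balancedE c) sw.
have cps b M := count_ps_pred2 b M _ j0.
(* In an unbalanced prefix one kind occurs more than [j] times and the other fewer, so the block
   would start with two equal letters. *)
case: ((count_mem c w).*2 =P j.*2) => [cwj | ncwj] /=; last first.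
  apply/eqP => psL; have := prefix_ps w (drop j.*2 L) (pred2 j j.+1).
  rewrite -Lw psL => /prefixP[s psw].
  have sz : size (ps w (pred2 j j.+1)) = 2%N.
    by rewrite -(count_mem_step c) !cps; move: (count_mem c w) (count_mem _ w) cw; lia.
  have := cps c w; rewrite -(take_size_cat s sz) -psw.
  have -> : count_mem c (take 2 [:: ~~ c; c; c; ~~ c]) = 1%N by case: (c).
  by move: (count_mem c w) ncwj; lia.
case: (lastP w) sw cwj cw Lw => [|w' x] sw cwj cw Lw; first by rewrite /= in sw; lia.
case: (drop j.*2 L) Lw => [|y r] Lw.
  by rewrite cats0 in Lw; rewrite Lw sw in sL; lia.
have cwx b : count_mem b (rcons w' x) = j.
  have [->|] := eqVneq b c; first by apply: double_inj.
  move=> bc; have -> : b = ~~ c by case: b (c) bc => -[].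
  lia.
rewrite last_rcons [in nth _ _ _]Lw nth_cat sw ltnn subnn /=.
have psw : ps (rcons w' x) (pred2 j j.+1) = rcons (ps w' (pred2 j j.+1)) x.
  have := cwx x; rewrite ps_rcons -!cats1 count_cat /= eqxx addn0 addn1 => ->.
  by rewrite /= eqxx.
have [s psL] : exists s, ps L (pred2 j j.+1) = ps w' (pred2 j j.+1) ++ [:: x, y & s].
  have := prefix_ps (rcons (rcons w' x) y) r (pred2 j j.+1).
  rewrite cat_rcons -Lw ps_rcons psw cwx /= eqxx orbT /= => /prefixP[s ->].
  by exists s; rewrite -!cats1 -!catA.
have cw'1 b : count_mem b (rcons (ps w' (pred2 j j.+1)) x) = 1%N.
  by rewrite -psw cps cwx; lia.
have c2 b : count_mem b (ps L (pred2 j j.+1)) = 2%N.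
  by rewrite cps; have -> : count_mem b L = n; [case: b (c) cL cL' => -[] | lia].
have sw' : size (ps w' (pred2 j j.+1)) = 1%N.
  by apply: succn_inj; rewrite -(size_rcons _ x) -(count_mem_step c) !cw'1.
have ss : size s = 1%N.
  have := count_mem_step c (ps L (pred2 j j.+1)).
  by rewrite !c2 psL size_cat sw' => -[].
move: (cw'1 true) (c2 true) sw' ss; rewrite psL.
case: (ps w' _) => [|z [|? ?]] //; case: (s) => [|u [|? ?]] //.
by case: (z); case: (u); case: (x); case: (y); case: (c).
Qed.

Lemma negb_eqF (c : bool) : (~~ c == c) = false.
Proof. by case: c. Qed.

(** All positions are scanned, not only the even ones, so that appending a letter adds a single
    term; odd positions contribute nothing, since a balanced prefix has even length. *)
Definition passages (c : step) (L : seq step) : nat :=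
  count (straight c L) (iota 0 (size L)).

Lemma count_iota_double (P : pred nat) (n : nat) :
  (forall k, odd k -> ~~ P k) ->
  count P (iota 0 n.*2) = count (P \o double) (iota 0 n).
Proof.
move=> Podd; elim: n => // n IHn.
rewrite doubleS -[in RHS]addn1 -addn2 !iotaD !count_cat IHn /= !add0n.
by rewrite (negbTE (Podd n.*2.+1 _)) //= odd_double.
Qed.

Lemma mch_passages (c : step) (n : nat) (L : seq step) :
  count_mem c L = n -> size L = n.*2 ->
  mch [:: ~~ c; c; c; ~~ c] n L = passages c L.
Proof.
move=> cL sL; rewrite /passages sL count_iota_double; last first.
  move=> k oddk; rewrite /straight (balancedE c).
  case: (ltnP k (size L)) => kL.
    rewrite (size_takel (ltnW kL)); case: eqP => // ck.
    by rewrite -ck odd_double in oddk.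
  by rewrite nth_default // negb_eqF !andbF.
case: n cL sL => [|n] cL sL //.
have s0 : straight c L 0 = false by rewrite /straight take0 /= negb_eqF.
rewrite [in RHS]/= s0 add0n; apply: eq_in_count => j; rewrite mem_iota => jn /=.
by rewrite (@ps_pred2_straight c n.+1).
Qed.

Lemma passages_rcons (c : step) (w : seq step) (y : step) :
  passages c (rcons w y) =
  (passages c w + [&& balanced w, last (~~ c) w == c & y == c])%N.
Proof.
rewrite /passages size_rcons -[(size w).+1]addn1 iotaD count_cat /= addn0 add0n.
congr addn; last first.
  by rewrite /straight -cats1 take_size_cat // nth_cat ltnn subnn.
apply: eq_in_count => k; rewrite mem_iota /= add0n => kw.
by rewrite /straight -cats1 takel_cat ?(ltnW kw) // nth_cat kw.
Qed.

(** * Weighted words classified by their last letter *)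

Lemma sum_tuple_rcons (T : finType) (V : nmodType) (N : nat) (P : pred (seq T))
    (F : seq T -> V) :
  \sum_(L : N.+1.-tuple T | P L) F L =
  \sum_(y : T) \sum_(L : N.-tuple T | P (rcons L y)) F (rcons L y).
Proof.
rewrite pair_big_dep /=.
pose h (z : T * N.-tuple T) := [tuple of rcons z.2 z.1].
have h_inj : injective h.
  move=> [y L] [y' L'] /(congr1 val) /= /rcons_inj[LL' ->].
  by congr pair; apply: val_inj.
rewrite (reindex h) //; apply: onW_bij; apply: inj_card_bij => //.
by rewrite card_prod !card_tuple expnS.
Qed.

Section WeightedWords.
Variables (R : comNzRingType) (x : bool -> R).

Definition weight (L : seq step) : R :=
  x true ^+ passages true L * x false ^+ passages false L.

Lemma weight_rcons (c : step) (w : seq step) :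
  weight (rcons w c) =
  (if balanced w && (last (~~ c) w == c) then x c else 1) * weight w.
Proof.
rewrite /weight !passages_rcons !exprD.
by case: c => /=; rewrite andbT ?andbF; case: ifP => _ /=; ring.
Qed.

(** The default letter [~~ c] of [last] excludes the empty word. *)
Definition ending (c : step) (p q : nat) : R :=
  \sum_(L : (p + q).-tuple step |
    (count_mem c L == p) && (last (~~ c) L == c)) weight L.

Lemma ending0 (c : step) (q : nat) : ending c 0 q = 0.
Proof.
rewrite /ending big1 // => L /andP[/eqP cL /eqP lL].
have /count_memPn/negP[] := cL.
case: {cL} (tval L) lL => [|a l] /=; first by case: (c).
by move=> <-; rewrite mem_last.
Qed.

(** Remove the final [c]: what remains is empty, ends with [c], or ends with [~~ c]. A factor [x c]
    arises only in the second case, and only if the remaining word is balanced, that is [p == q]. *)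
Lemma endingS (c : step) (p q : nat) :
  ending c p.+1 q = ((p == 0%N) && (q == 0%N))%:R
    + (if p == q then x c else 1) * ending c p q + ending (~~ c) q p.
Proof.
rewrite /ending [(q + p)%N]addnC addSn.
rewrite (sum_tuple_rcons _ _ _
  (fun L => (count_mem c L == p.+1) && (last (~~ c) L == c))).
rewrite (bigD1 c) //= [X in _ + X = _]big1 ?addr0; last first.
  move=> y yc; rewrite big_pred0 // => L.
  by rewrite last_rcons (negbTE yc) andbF.
rewrite (eq_bigl (fun L : (p + q).-tuple step => count_mem c L == p)); last first.
  by move=> L; rewrite -cats1 count_cat last_cat /= eqxx addn0 addn1 andbT.
rewrite (bigID (fun L : (p + q).-tuple step => last (~~ c) L == c)) /=.
rewrite [in RHS]addrC [in RHS]addrA [RHS]addrC; congr (_ + _).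
  rewrite big_distrr; apply: eq_bigr => L /andP[/eqP cL lL].
  rewrite weight_rcons lL andbT (balancedE c) cL size_tuple.
  by rewrite -addnn eqn_add2l.
rewrite (eq_bigr (fun L : (p + q).-tuple step => weight L)); last first.
  by move=> L /andP[_ /negbTE lL]; rewrite weight_rcons lL andbF mul1r.
(* The empty word falls into this half of the split but is excluded from [ending (~~ c)]; it
   accounts for the separate term 1. *)
have [pq0|pq0] := eqVneq (p + q)%N 0%N.
  move/eqP: (pq0); rewrite addn_eq0 => /andP[/eqP -> /eqP ->] /=.
  rewrite (big_pred1 [tuple]); last first.
    by move=> L; rewrite tuple0 /= negb_eqF eqxx.
  rewrite big_pred0; first by rewrite add0r /weight mulr1.
  by move=> L; rewrite tuple0 /= negbK; case: (c).
have -> : (p == 0%N) && (q == 0%N) = false by lia.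
rewrite addr0; apply: eq_bigl => L; congr (_ && _).
  rewrite -(eqn_add2r (count_mem (~~ c) L)) count_mem_step size_tuple.
  by rewrite eqn_add2l eq_sym.
case: (tval L) (size_tuple L) => [/esym/eqP|a l _ /=]; first by rewrite (negbTE pq0).
by case: (last a l) (c) => -[].
Qed.
End WeightedWords.

(** * Solving the recurrence by powers of the Catalan series *)

Lemma fcoef_constM (R : comNzRingType) (r : R) (a : fps R) n :
  fcoef (fps_const r * a) n = r * fcoef a n.
Proof.
rewrite fcoefM big_ord_recl big1 /= ?subn0 ?addr0 // => i _.
by rewrite mul0r.
Qed.

Lemma fcoef_tMS (R : comNzRingType) (a : fps R) n : fcoef (fps_t R * a) n.+1 = fcoef a n.
Proof. exact: fcoef_tM. Qed.

Section Recurrence.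
Variables (R : comNzRingType) (x : bool -> R) (w : bool -> nat -> nat -> R).
Hypothesis w0 : forall c q, w c 0 q = 0.
Hypothesis wS : forall c p q, w c p.+1 q =
  ((p == 0%N) && (q == 0%N))%:R + (if p == q then x c else 1) * w c p q + w (~~ c) q p.

Variables (C : fps R) (P : bool -> fps R).
Hypothesis catalanE : C = 1 + fps_t R * C ^+ 2.
Hypothesis PE : forall c,
  P c = fps_t R * C ^+ 2 * (1 + fps_const (x (~~ c)) * P (~~ c)).

Let g c : fps R := 1 + fps_const (x (~~ c)) * P (~~ c).

(** Series form of the recurrence at height one above the diagonal: the last letter leaves the
    diagonal after the empty word, after a return by [c], or straight after a return by [~~ c]; or
    it is a [c] coming down from height two. *)
Let catalan_straight c :
  C ^+ 2 * g c = 1 + P c + fps_const (x (~~ c)) * P (~~ c) + fps_t R * (C ^+ 3 * g c).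
Proof.
have u : fps_t R * C ^+ 2 = C - 1 by rewrite {2}catalanE addrC addKr.
rewrite [P c]PE -/(g c) u -[C ^+ 3]/(C * C ^+ 2).
have -> : fps_t R * (C * C ^+ 2 * g c) = fps_t R * C ^+ 2 * (C * g c) by ring.
by rewrite u /g; ring.
Qed.

Let catalan_step c d :
  C ^+ d.+3 * g c = C ^+ d.+2 * g c + fps_t R * (C ^+ d.+4 * g c).
Proof.
have -> : C ^+ d.+3 = C ^+ d.+2 * C by rewrite exprSr.
rewrite {2}catalanE -[d.+4]addn2 exprD; ring.
Qed.

(** The excess of letters [~~ c] is [d.+1], hence positive; both possible last letters are added
    up. *)
Let below_diagonal c p d := w c p (p + d.+1) + w (~~ c) (p + d.+1) p.

Let fcoefP0 c : fcoef (P c) 0 = 0.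
Proof. by rewrite PE -mulrA fcoef_tM. Qed.

Let fcoefPS c p : fcoef (P c) p.+1 = fcoef (C ^+ 2 * g c) p.
Proof. by rewrite PE -mulrA fcoef_tM. Qed.

Let w_off_diagonal c p q : p != q -> w c p.+1 q = w c p q + w (~~ c) q p.
Proof.
by move=> pq; rewrite wS (negbTE pq) mul1r; case: p q pq => [|p] [|q] // _; rewrite add0r.
Qed.

Let returnS c p : w c p.+1 p.+1 = below_diagonal c p 0.
Proof. by rewrite w_off_diagonal ?ltn_eqF // /below_diagonal addn1. Qed.

(** Induction on a bound [N] for the word length [p + (p + d.+1)]: both sides obey the same
    recurrence, which only refers to shorter words. *)
Let below_diagonal_coef N c p d : (p + p + d < N)%N ->
  below_diagonal c p d = fcoef (C ^+ d.+2 * g c) p.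
Proof.
elim: N c p d => // N IHN c p [|d] hN; rewrite /below_diagonal.
  rewrite catalan_straight !fcoefD fcoef_constM fcoef1 addn1 [w _ p.+1 p]wS.
  rewrite eqxx negbK; case: p hN => [|p] hN.
    by rewrite fcoef_tM !w0 !fcoefP0 !mulr0 !addr0 add0r.
  rewrite fcoef_tMS !fcoefPS returnS w_off_diagonal; last by rewrite ltn_eqF.
  rewrite returnS -!IHN; try lia.
  by rewrite /below_diagonal !negbK addn1 addn2; ring.
rewrite catalan_step fcoefD addnS [w (~~ c) _.+1 p]w_off_diagonal; last by lia.
rewrite negbK -(IHN c p d); last by lia.
case: p hN => [|p] hN; first by rewrite fcoef_tM !w0 /below_diagonal w0; ring.
rewrite fcoef_tMS [w c p.+1 (_ + d.+1).+1]w_off_diagonal; last by lia.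
by rewrite -IHN /below_diagonal ?addnS ?addSn ?addnS; [ring | lia].
Qed.

Lemma diagonal_coef c p : w c p p = fcoef (P c) p.
Proof.
case: p => [|p]; first by rewrite w0 fcoefP0.
by rewrite returnS fcoefPS (@below_diagonal_coef (p + p + 0).+1).
Qed.
End Recurrence.

(** * The quadratic equation of the Catalan series *)

Lemma catalan_gf_rec (R : comUnitRingType) : (2%:R : R) \is a GRing.unit ->
  catalan_gf R = 1 + fps_t R * catalan_gf R ^+ 2.
Proof.
move=> u2; have E := catalan_gfE u2.
have u4 : (4%:R : fps R) \is a GRing.unit.
  by rewrite fps_unitE fcoef_nat (natrM _ 2 2) unitrM u2.
have t_inj (a b : fps R) : fps_t R * a = fps_t R * b -> a = b.
  move=> ab; apply: fpsP => n.
  by rewrite -fcoef_tMS ab fcoef_tMS.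
have S : fps_sqrt (1 - 4%:R * fps_t R) ^+ 2 = 1 - 4%:R * fps_t R.
  by apply: fps_sqrtK => //; rewrite fcoefD fcoefN fcoef1 mulrC fcoef_tM subr0.
have {E} E : fps_sqrt (1 - 4%:R * fps_t R) = 1 - 2%:R * fps_t R * catalan_gf R.
  by rewrite E; ring.
apply: t_inj; apply: (mulrI u4); move: S; rewrite E.
set C := catalan_gf R; set t := fps_t R => S.
(* The added difference vanishes by [S]; with it the goal is a polynomial identity. *)
have -> : 4%:R * (t * C) = 4%:R * (t * C) + ((1 - 2%:R * t * C) ^+ 2 - (1 - 4%:R * t)).
  by rewrite S subrr addr0.
ring.
Qed.

(** * The closed form *)

Lemma in_lattice_paths (c : step) (n : nat) (L : (n + n).-tuple step) :
  (L \in lattice_paths n) = (count_mem c L == n).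
Proof.
have cs := count_mem_step c L; rewrite size_tuple in cs.
have cL : count_mem c L = n -> count_mem (~~ c) L = n.
  by move=> cL; apply: (@addnI n); rewrite -{1}cL cs.
rewrite inE; case: c cL {cs} => cL; last rewrite andbC.
- by apply/andP/eqP => [[/eqP]//|ct]; rewrite ct cL.
- by apply/andP/eqP => [[/eqP]//|ct]; rewrite ct cL.
Qed.

Lemma weight_mch (R : comNzRingType) (x : bool -> R) (n : nat) (L : (n + n).-tuple step) :
  L \in lattice_paths n ->
  weight R x L = x true ^+ mch P3 n L * x false ^+ mch P4 n L.
Proof.
rewrite inE => /andP[/eqP cE /eqP cN].
have sL : size L = n.*2 by rewrite size_tuple addnn.
by rewrite /weight -(mch_passages true n L) // -(mch_passages false n L).
Qed.

Lemma F34E (P : bool -> fps {mpoly rat[2]}) :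
  (forall c n, ending _ (fun b : bool => if b then x3 else x4) c n n = fcoef (P c) n) ->
  F34 = 1 + (P true + P false).
Proof.
move=> PE; rewrite /F34; congr (_ + _).
apply: fpsP => -[|n]; rewrite fcoefD -!PE; first by rewrite !ending0 addr0.
transitivity (\sum_(L : (n.+1 + n.+1).-tuple step | L \in lattice_paths n.+1)
  weight _ (fun b : bool => if b then x3 else x4) L).
  by apply: eq_bigr => L LP; rewrite weight_mch.
(* Nonempty paths split by their last letter into the two sums [ending]. *)
rewrite (bigID (fun L : (n.+1 + n.+1).-tuple step => last false L == true)).
congr (_ + _); apply: eq_bigl => L; first by rewrite (in_lattice_paths true).
rewrite (in_lattice_paths false); congr andb.
by case: L => -[|a l] //= _; case: (last a l).
Qed.

Theorem mainTheorem10 :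
  let C : fps {mpoly rat[2]} := catalan_gf {mpoly rat[2]} in
  let X3 : fps {mpoly rat[2]} := fps_const x3 in
  let X4 : fps {mpoly rat[2]} := fps_const x4 in
  F34 = C + ((1 - C) * (1 - X3 + C * X3) * (1 - X4 + C * X4))
            / (- 1 + (- 1 + C) ^+ 2 * X3 * X4).
Proof.
move=> C X3 X4; set U := -1 + _.
have uU : U \is a GRing.unit by apply: denom_unit unit2.
have UV : U * U^-1 = 1 by rewrite divrr.
pose x (b : bool) := if b then x3 else x4.
(* Since [t * C ^ 2 = C - 1], the equations for [P true] and [P false] form a linear system; this is
   its solution by elimination, with determinant [U] up to sign. *)
pose P (b : bool) : fps {mpoly rat[2]} :=
  (1 - C) * (1 + fps_const (x (~~ b)) * (C - 1)) / U.
have catE : C = 1 + fps_t _ * C ^+ 2 by apply: catalan_gf_rec unit2.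
have PE c : P c = fps_t _ * C ^+ 2 * (1 + fps_const (x (~~ c)) * P (~~ c)).
  have -> : fps_t _ * C ^+ 2 = C - 1 by rewrite {2}catE addrC addKr.
  rewrite /P negbK.
  (* Writing 1 as [U * U^-1] puts a factor [U^-1] in every term, so the equality is polynomial with
     [U^-1] as an indeterminate. *)
  rewrite -[X in _ = _ * (X + _)]UV.
  case: c; rewrite /= -/X3 -/X4 /U; set V := _^-1; ring.
rewrite (F34E P) => [|c n].
  rewrite -[X in X + _ = _]UV.
  rewrite -[X in _ = X + _]mulr1 -[X in _ = _ * X + _]UV.
  rewrite /P /= -/X3 -/X4 /U; set V := _^-1; ring.
exact: (diagonal_coef _ x (ending _ x) (ending0 _ x) (endingS _ x) C P catE PE).
Qed.
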